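(* Let $c\ge 1$ be a fixed integer and let $p\in(0,1)$ be fixed, $q=1-p$. Let $(N_k)_{k\ge1}$ and $(m_k)_{k\ge1}$ be sequences of positive integers with $N_k\to\infty$, $m_k\to\infty$, $m_k/N_k=p$ for all $k$, and $c\le m_k$, $c\le N_k-m_k$. Let $Y_k$ be a random variable with the maximum negative hypergeometric distribution with parameters $(N_k,m_k,c)$. Then $Y_k$ converges in distribution, as $k\to\infty$, to the maximum negative binomial distribution with parameters $c$ and $p$; that is, for every integer $y\ge0$, $$\lim_{k\to\infty}\Pr[Y_k=y]=\binom{2c+y-1}{c-1}\,(p^y+q^y)\,(pq)^c .$$
   Context: For a real number $z$ and integer $k\ge1$, $z^{(k)}=z(z-1)\cdots(z-k+1)$ is the falling factorial, and $z^{(0)}=1$. Maximum negative hypergeometric distribution with integer parameters $(N,m,c)$, where $1\le c\le m<N$ and $c\le N-m$: an urn contains $N$ balls, $m$ of one color and $N-m$ of another; balls are drawn without replacement until at least $c$ balls of both colors have been observed; $Y$ is the number of draws needed minus $2c$. Its probability mass function is $$\Pr[Y=y]=\binom{2c+y-1}{c-1}\,\frac{m^{(c+y)}(N-m)^{(c)}+m^{(c)}(N-m)^{(c+y)}}{N^{(2c+y)}},\qquad 0\le y\le\max\{m-c,\,N-m-c\},$$ and $\Pr[Y=y]=0$ for other $y$. Maximum negative binomial distribution with parameters $c$ and $p$ ($q=1-p$): the distribution of the number of independent Bernoulli$(p)$ trials needed to observe at least $c$ successes and at least $c$ failures, minus $2c$. Its probability mass function is $\Pr[Y=y]=\binom{2c+y-1}{c-1}(p^y+q^y)(pq)^c$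 for $y=0,1,2,\ldots$. *)

(* Defs.v *)
From HB Require Import structures.
From mathcomp Require Import all_boot all_order all_algebra.
From mathcomp Require Import all_classical all_reals all_analysis.
From mathcomp Require Import ring lra zify.

Set Implicit Arguments.
Unset Strict Implicit.
Unset Printing Implicit Defensive.

Import Order.TTheory GRing.Theory Num.Theory.
Import numFieldNormedType.Exports.

Local Open Scope classical_set_scope.
Local Open Scope ring_scope.

(* [m ^_ k] is the falling factorial
   m (m - 1) ... (m - k + 1); it vanishes for k > m, as the real product does. *)
Definition max_neg_hypergeometric_pmf {R : realType} (N m c y : nat) : R :=
  if (y <= maxn (m - c) (N - m - c))%N then
    'C(2 * c + y - 1, c - 1)%:R *
      ((m ^_ (c + y))%:R * ((N - m) ^_ c)%:R +
       (m ^_ c)%:R * ((N - m) ^_ (c + y))%:R) / (N ^_ (2 * c + y))%:R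
  else 0.

Definition max_neg_binomial_pmf {R : realType} (c : nat) (p : R) (y : nat) : R :=
  'C(2 * c + y - 1, c - 1)%:R * (p ^+ y + (1 - p) ^+ y) * (p * (1 - p)) ^+ c.

(* The law on the real line that gives mass [f y] to each natural number y. *)
Definition nat_law {R : realType} (f : nat -> R) (U : set R) : \bar R :=
  (\esum_(y in [set y : nat | U y%:R]) (f y)%:E)%E.

(* Outside the parameter range the two laws below default to a Dirac mass, so
   that they are probability measures for all parameters. *)
Definition max_neg_hypergeometric_prob {R : realType} (N m c : nat)
    (U : set R) : \bar R :=
  if [&& 0 < c, c <= m, m < N & c <= N - m]%N
  then nat_law (max_neg_hypergeometric_pmf N m c) U else \d_(0 : R) U.

Definition max_neg_binomial_prob {R : realType} (c : nat) (p : R)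
    (U : set R) : \bar R :=
  if (0 < c)%N && (0 < p < 1)
  then nat_law (max_neg_binomial_pmf c p) U else \d_(0 : R) U.

(* Equality of laws is only required on Borel sets. *)
Definition has_law {d} {T : measurableType d} {R : realType}
    {P : probability T R} (Y : {RV P >-> R}) (mu : probability R R) : Prop :=
  forall U : set R, measurable U -> distribution P Y U = mu U.

(* The variables may live on different probability spaces. *)
Definition cvg_in_distribution {R : realType} {d : nat -> measure_display}
    {T : forall k, measurableType (d k)} {P : forall k, probability (T k) R}
    (Y : forall k, {RV (P k) >-> R})
    (mu : probability R R) : Prop :=
  forall x : R, {for x, continuous (fun t : R => mu `]-oo, t]%classic)} ->
    cdf (Y k) x @[k --> \oo] --> mu `]-oo, x]%classic.

(* The rest of the file shows that the two laws are probability measures. *)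

(* In both models, a given sequence of i + j draws with i balls of the first
   kind and j of the second has a probability A i j that depends on i and j only.
   [few A c n] is then the probability of fewer than c balls of the first kind
   among the first n draws. *)
Section weights.
Context {R : realType}.
Implicit Types (A : nat -> nat -> R) (c n : nat).

Definition few A c n : R := \sum_(j < c) ('C(n, j))%:R * A j (n - j)%N.

Lemma few_rec A c n :
  (forall i j, (i + j)%N = n -> A i j = A i.+1 j + A i j.+1) -> (c <= n)%N ->
  few A c.+1 n = few A c.+1 n.+1 + ('C(n, c))%:R * A c.+1 (n - c)%N.
Proof.
move=> hA; elim: c => [|c IH] cn.
  by rewrite /few !big_ord_recl !big_ord0 !addr0 !bin0 !subn0 hA// addrC !mul1r.
have := IH (ltnW cn); rewrite /few big_ord_recr/= [in RHS]big_ord_recr/=.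
rewrite [X in _ -> X = _]big_ord_recr/= [X in _ -> _ = X + _]big_ord_recr/=.
rewrite -/(few A c n) => E.
rewrite [X in X + _ = _]big_ord_recr/= [X in _ = X + _ + _]big_ord_recr/= E.
rewrite (hA c.+1 (n - c.+1)%N) ?subnKC// binS natrD !mulrDl !mulrDr.
have -> : (n - c.+1).+1 = (n - c)%N by lia.
have -> : (n.+1 - c.+1 = n - c)%N by lia.
ring.
Qed.

Lemma few_full A n :
  (forall i j, (i + j < n)%N -> A i j = A i.+1 j + A i j.+1) ->
  few A n.+1 n = A 0 0.
Proof.
elim: n => [|n IH] hA.
  by rewrite /few big_ord_recl big_ord0 bin0 mul1r addr0.
rewrite -IH; last by move=> i j ij; apply: hA; lia.
rewrite (few_rec (c := n) (n := n))//; last by move=> i j ij; apply: hA; lia.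
by rewrite {1}/few big_ord_recr/= -/(few A n.+1 n.+1) !subnn !binn.
Qed.

Lemma few_split A c : few A (2 * c.+1) (2 * c.+1 - 1) =
  few A c.+1 (2 * c.+1 - 1) + few (fun i j => A j i) c.+1 (2 * c.+1 - 1).
Proof.
rewrite {1}/few mul2n -addnn big_split_ord/=; congr (_ + _).
rewrite (reindex_inj rev_ord_inj)/=; apply: eq_bigr => i _.
have ic := ltn_ord i.
rewrite -bin_sub; last by lia.
by congr ('C(_, _)%:R * A _ _); lia.
Qed.

Lemma sum_two_sided A c K : (0 < c)%N -> A 0 0 = 1 ->
  (forall i j, (i + j < 2 * c - 1 + K)%N -> A i j = A i.+1 j + A i j.+1) ->
  \sum_(y < K) 'C(2 * c + y - 1, c - 1)%:R * (A (c + y)%N c + A c (c + y)%N) =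
  1 - (few A c (2 * c - 1 + K) + few (fun i j => A j i) c (2 * c - 1 + K)).
Proof.
case: c => // c _ A00; elim: K => [|K IH] hA.
  rewrite big_ord0 addn0 -few_split -A00.
  have {1}-> : (2 * c.+1 = (2 * c.+1 - 1).+1)%N by lia.
  by rewrite few_full ?subrr// => i j ij; apply: hA; lia.
rewrite big_ord_recr/= IH; last by move=> i j ij; apply: hA; lia.
have hA' i j : (i + j = 2 * c.+1 - 1 + K)%N -> A i j = A i.+1 j + A i j.+1.
  by move=> ij; apply: hA; lia.
rewrite (few_rec (A := A) (c := c) hA'); last by lia.
rewrite (few_rec (A := fun i j => A j i) (c := c)); last 2 first.
- by move=> i j ij; rewrite addrC; apply: hA'; lia.
- by lia.
have -> : (2 * c.+1 + K - 1 = 2 * c.+1 - 1 + K)%N by lia.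
rewrite -addnS [(c.+1 - 1)%N]subn1/=.
have -> : (2 * c.+1 - 1 + K - c = c.+1 + K)%N by lia.
ring.
Qed.

End weights.

Section pmf_sums.
Context {R : realType}.

Lemma max_neg_hypergeometric_pmf_ge0 N m c y :
  0 <= max_neg_hypergeometric_pmf N m c y :> R.
Proof.
by rewrite /max_neg_hypergeometric_pmf; case: ifP => // _;
  rewrite divr_ge0// mulr_ge0// addr_ge0// mulr_ge0.
Qed.

Lemma max_neg_binomial_pmf_ge0 c (p : R) y :
  0 < p < 1 -> 0 <= max_neg_binomial_pmf c p y.
Proof.
move=> /andP[p0 p1]; have q0 : 0 <= 1 - p by lra.
rewrite /max_neg_binomial_pmf mulr_ge0 ?exprn_ge0 ?mulr_ge0 ?(ltW p0)//.
by rewrite addr_ge0 ?exprn_ge0 ?(ltW p0).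
Qed.

Lemma max_neg_hypergeometric_pmf_sum N m c K :
  (0 < c)%N -> (c <= m)%N -> (c <= N - m)%N ->
  (maxn (m - c) (N - m - c) < K)%N ->
  \sum_(y < K) max_neg_hypergeometric_pmf N m c y = 1 :> R.
Proof.
move=> c0 cm cM KM; set L := (maxn (m - c) (N - m - c)).+1.
pose A i j : R := (m ^_ i)%:R * ((N - m) ^_ j)%:R / (N ^_ (i + j))%:R.
have L2 : (2 * c - 1 + L <= N)%N by rewrite /L; lia.
have AS i j : (i + j < 2 * c - 1 + L)%N -> A i j = A i.+1 j + A i j.+1.
  move=> ij; rewrite /A addSn addnS !ffactnSr !natrM.
  have N0 : (N ^_ (i + j))%:R != 0 :> R by rewrite pnatr_eq0 -lt0n ffact_gt0; lia.
  have N1 : (N - (i + j))%:R != 0 :> R by rewrite pnatr_eq0 -lt0n; lia.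
  have [mi|mi] := ltnP m i; first by rewrite ffact_small//; field; rewrite N0 N1.
  have [Mj|Mj] := ltnP (N - m) j.
    by rewrite (ffact_small Mj); field; rewrite N0 N1.
  have E : (N - (i + j))%:R = (m - i)%:R + (N - m - j)%:R :> R.
    by rewrite -natrD; congr (_%:R); lia.
  move: N1; rewrite E => N1; field; rewrite N1 N0//.
have -> : \sum_(y < K) max_neg_hypergeometric_pmf N m c y =
    \sum_(y < L) 'C(2 * c + y - 1, c - 1)%:R * (A (c + y)%N c + A c (c + y)%N).
  rewrite (big_ord_widen K (fun y => 'C(2 * c + y - 1, c - 1)%:R *
    (A (c + y)%N c + A c (c + y)%N)) KM).
  rewrite (bigID (fun y : 'I_K => (y < L)%N))/= [X in _ + X]big1 ?addr0; last first.
    by move=> y; rewrite /max_neg_hypergeometric_pmf ltnS => /negbTE ->.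
  apply: eq_bigr => y; rewrite ltnS /max_neg_hypergeometric_pmf => ->.
  rewrite /A; have -> : (c + y + c = 2 * c + y)%N by lia.
  have -> : (c + (c + y) = 2 * c + y)%N by lia.
  ring.
rewrite sum_two_sided//; last by rewrite /A !ffactn0 divr1 mul1r.
rewrite /few !big1 ?addr0 ?subr0// => j _; have jc := ltn_ord j; rewrite /A.
  rewrite [(m ^_ _)%N]ffact_small ?(mul0r, mulr0)//; rewrite /L; lia.
rewrite [((N - m) ^_ _)%N]ffact_small ?(mul0r, mulr0)//; rewrite /L; lia.
Qed.

Lemma cvg_few_binomial c (p : R) : 0 < p < 1 ->
  few (fun i j => p ^+ i * (1 - p) ^+ j) c n @[n --> \oo] --> (0 : R).
Proof.
move=> /andP[p0 p1]; pose r : R := 1 - p / 2.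
have r0 : 0 < r by rewrite /r; lra.
have r1 : r < 1 by rewrite /r; lra.
have q0 : 0 <= 1 - p by lra.
apply: (@squeeze_cvgr _ _ _ _ (fun=> 0) (geometric (\sum_(j < c) 2 ^+ j) r)).
- near=> n; have nc : (c <= n)%N by near: n; exact: nbhs_infty_ge.
  rewrite /few sumr_ge0/=; last first.
    by move=> i _; rewrite !mulr_ge0// exprn_ge0// ltW.
  rewrite mulr_suml ler_sum// => j _.
  have jn : (j < n.+1)%N by have := ltn_ord j; lia.
  have -> : r = (1 - p) + p / 2 by rewrite /r; lra.
  rewrite [X in _ <= _ * X]exprDn (bigD1 (Ordinal jn))//= mulrDr.
  have -> : p ^+ j = 2 ^+ j * (p / 2) ^+ j by rewrite -exprMn mulrCA divff ?mulr1.
  apply: le_trans (_ : _ <= 2 ^+ j * ((1 - p) ^+ (n - j) * (p / 2) ^+ j *+ 'C(n, j))) _.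
    by rewrite -[_ *+ 'C(_, _)]mulr_natl; rewrite le_eqVlt; apply/orP; left; apply/eqP; ring.
  rewrite lerDl mulr_ge0 ?exprn_ge0// sumr_ge0// => i _.
  by rewrite mulrn_wge0// mulr_ge0// exprn_ge0// divr_ge0// ltW.
- exact: cvg_cst.
- by apply: cvg_geometric; rewrite ger0_norm// ltW.
Unshelve. all: by end_near. Qed.

Lemma max_neg_binomial_pmf_sum c (p : R) : (0 < c)%N -> 0 < p < 1 ->
  series (max_neg_binomial_pmf c p) @ \oo --> (1 : R).
Proof.
move=> c0 p01; pose A i j := p ^+ i * (1 - p) ^+ j.
have -> : series (max_neg_binomial_pmf c p) = fun K => 1 -
    (few A c (2 * c - 1 + K) + few (fun i j => A j i) c (2 * c - 1 + K)).
  apply/funext => K; rewrite /series/= big_mkord -sum_two_sided//; last 2 first.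
  - by rewrite /A !expr0 mulr1.
  - by move=> i j _; rewrite /A !exprS; ring.
  apply: eq_bigr => y _; rewrite /max_neg_binomial_pmf /A exprMn !exprD; ring.
rewrite -[X in _ --> X]subr0 -[X in _ --> _ - X]addr0.
have sh (u : R^nat) : u @ \oo --> (0 : R) ->
    u (2 * c - 1 + K)%N @[K --> \oo] --> (0 : R).
  by move=> u0; apply: (cvg_comp _ _ (cvg_addnl (2 * c - 1)) u0).
apply: cvgB; first exact: cvg_cst.
apply: cvgD; apply: sh; first exact: cvg_few_binomial.
have q01 : 0 < 1 - p < 1 by move/andP: p01 => [? ?]; apply/andP; split; lra.
rewrite (_ : few _ c = few (fun i j => (1 - p) ^+ i * (1 - (1 - p)) ^+ j) c).
  exact: cvg_few_binomial.
by apply/funext => n; apply: eq_bigr => j _; rewrite /A subKr [p ^+ _ * _]mulrC.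
Qed.

End pmf_sums.

Section nat_law.
Context {R : realType} (f : nat -> R).
Hypothesis f0 : forall y, 0 <= f y.
Local Open Scope ereal_scope.

Lemma nat_law0 : nat_law f set0 = 0.
Proof.
by rewrite /nat_law (_ : [set y | _] = set0) ?esum_set0//; apply/seteqP; split.
Qed.

Lemma nat_law_ge0 U : 0 <= nat_law f U.
Proof. by apply: esum_ge0 => y _; rewrite lee_fin. Qed.

Lemma nat_law_sigma_additive : semi_sigma_additive (nat_law f).
Proof.
move=> F mF tF mUF; apply: cvg_toP.
  apply: ereal_nondecreasing_is_cvgn => a b ab.
  by apply: lee_sum_nneg_natr => // n _ _; exact: nat_law_ge0.
rewrite /nat_law (_ : [set y : nat | _] =
    \bigcup_n [set y : nat | F n y%:R]); last by apply/seteqP; split.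
rewrite nneseries_sum_bigcup.
- by [].
- by move=> i j _ _ [y [Fi Fj]]; apply: tF => //; exists y%:R.
- by move=> y; rewrite lee_fin.
Qed.

Lemma nat_law_setT : series f @ \oo --> (1%R : R) -> nat_law f setT = 1.
Proof.
move=> f1; rewrite /nat_law (_ : [set y | _] = setT); last by apply/seteqP; split.
rewrite -nneseries_esumT; last by move=> y; rewrite lee_fin.
apply/cvg_lim => //; rewrite (_ : (fun n => _) = EFin \o series f); last first.
  by apply/funext => n; rewrite /= /series/= sumEFin.
by apply: cvg_EFin => //; exact: nearW.
Qed.

End nat_law.

Section max_neg_hypergeometric.
Context {R : realType} (N m c : nat).
Local Open Scope ereal_scope.

Local Notation mu := (@max_neg_hypergeometric_prob R N m c).

Let mu0 : mu set0 = 0.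
Proof.
by rewrite /max_neg_hypergeometric_prob measure0 nat_law0; case: ifP.
Qed.

Let mu_ge0 U : 0 <= mu U.
Proof.
rewrite /max_neg_hypergeometric_prob; case: ifP => // _.
by apply: nat_law_ge0 => y; exact: max_neg_hypergeometric_pmf_ge0.
Qed.

Let mu_sigma_additive : semi_sigma_additive mu.
Proof.
move=> F; rewrite /max_neg_hypergeometric_prob; case: ifP => _.
  by apply: nat_law_sigma_additive => y; exact: max_neg_hypergeometric_pmf_ge0.
exact: measure_semi_sigma_additive.
Qed.

HB.instance Definition _ := isMeasure.Build _ _ _ mu
  mu0 mu_ge0 mu_sigma_additive.

Let mu_setT : mu setT = 1.
Proof.
rewrite /max_neg_hypergeometric_prob; case: ifPn => [/and4P[c0 cm mN cM]|_].
  apply: nat_law_setT => [y|]; first exact: max_neg_hypergeometric_pmf_ge0.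
  apply: cvg_near_cst; near=> n; rewrite /series/= big_mkord.
  apply: max_neg_hypergeometric_pmf_sum => //.
  by near: n; exact: nbhs_infty_gt.
by rewrite probability_setT.
Unshelve. all: by end_near. Qed.

HB.instance Definition _ := @Measure_isProbability.Build _ _ R mu mu_setT.

End max_neg_hypergeometric.

Section max_neg_binomial.
Context {R : realType} (c : nat) (p : R).
Local Open Scope ereal_scope.

Local Notation mu := (max_neg_binomial_prob c p).

Let mu0 : mu set0 = 0.
Proof. by rewrite /max_neg_binomial_prob measure0 nat_law0; case: ifP. Qed.

Let mu_ge0 U : 0 <= mu U.
Proof.
rewrite /max_neg_binomial_prob; case: ifP => // /andP[_ p01].
by apply: nat_law_ge0 => y; exact: max_neg_binomial_pmf_ge0.
Qed.

Let mu_sigma_additive : semi_sigma_additive mu.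
Proof.
move=> F; rewrite /max_neg_binomial_prob; case: ifP => [/andP[_ p01]|_].
  by apply: nat_law_sigma_additive => y; exact: max_neg_binomial_pmf_ge0.
exact: measure_semi_sigma_additive.
Qed.

HB.instance Definition _ := isMeasure.Build _ _ _ mu
  mu0 mu_ge0 mu_sigma_additive.

Let mu_setT : mu setT = 1.
Proof.
rewrite /max_neg_binomial_prob; case: ifPn => [/andP[c0 p01]|_].
  apply: nat_law_setT => [y|]; first exact: max_neg_binomial_pmf_ge0.
  exact: max_neg_binomial_pmf_sum.
by rewrite probability_setT.
Qed.

HB.instance Definition _ := @Measure_isProbability.Build _ _ R mu mu_setT.

End max_neg_binomial.

(* Main.v *)
Require Import Defs.
From mathcomp Require Import all_boot all_order all_algebra.
From mathcomp Require Import all_classical all_reals all_analysis.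
From mathcomp Require Import finmap ring zify.
Import Order.TTheory GRing.Theory Num.Theory.
Import numFieldNormedType.Exports.
Local Open Scope classical_set_scope.
Local Open Scope ring_scope.

(** In a very large urn, a bounded number of draws without replacement is
    hardly distinguishable from draws with replacement: for a fixed number i of
    factors, m (m - 1) ... (m - i + 1) / N ^ i has the same limit as
    (m / N) ^ i, because each factor differs from m by at most i, which is
    negligible compared with N ([cvg_ffact_ratio]). Dividing the numerator and
    the denominator of the hypergeometric mass function at y by N ^ (2c + y)
    turns it into a rational expression in such ratios, so that it converges to
    the binomial mass function at y ([cvg_max_neg_hypergeometric_pmf]).

    All the laws live on the natural numbers, so a half-line ]-oo, x] meets
    their support in a finite set. Its mass is then a finite sum of values of
    the mass function, and pointwise convergence passes to that sum
    ([cvg_nat_law]). The distribution functions thus converge at every real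
    number. *)

Lemma cvg_ffact_ratio (R : realType) (N a : nat -> nat) (l : R) (i : nat) :
  N k @[k --> \oo] --> \oo -> (a k)%:R / (N k)%:R @[k --> \oo] --> l ->
  (a k ^_ i)%:R / (N k)%:R ^+ i @[k --> \oo] --> l ^+ i.
Proof.
move=> Noo al.
have invN0 : (N k)%:R^-1 @[k --> \oo] --> (0 : R).
  apply/gtr0_cvgV0; last exact/cvgrnyP.
  by near=> k; rewrite ltr0n; near: k; exact: (Noo _ (nbhs_infty_gt 0)).
have shift j : (a k - j)%:R / (N k)%:R @[k --> \oo] --> l.
  apply: (@squeeze_cvgr _ _ _ _
    (fun k => (a k)%:R / (N k)%:R - j%:R * (N k)%:R^-1)
    (fun k => (a k)%:R / (N k)%:R)) => //.
  - near=> k; rewrite -mulrBl !ler_wpM2r ?invr_ge0 ?ler0n//.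
      by rewrite ler_nat leq_subr.
    by rewrite lerBlDr -natrD ler_nat; lia.
  - rewrite -[X in _ --> X]subr0 -(mulr0 j%:R).
    by apply: cvgB => //; apply: cvgMr.
elim: i => [|i IH].
  under eq_cvg do rewrite ffactn0 expr0 divr1.
  exact: cvg_cst.
under eq_cvg do rewrite ffactnSr exprSr natrM invfM mulrACA.
by rewrite exprSr; apply: cvgM.
Unshelve. all: by end_near. Qed.

(** The cut-off in the definition of the mass function is harmless: past it,
    both y + c > m and y + c > N - m, and the falling factorials vanish. *)
Lemma max_neg_hypergeometric_pmfE (R : realType) (N m c y : nat) :
  max_neg_hypergeometric_pmf N m c y =
  'C(2 * c + y - 1, c - 1)%:R *
    ((m ^_ (c + y))%:R * ((N - m) ^_ c)%:R +
     (m ^_ c)%:R * ((N - m) ^_ (c + y))%:R) / (N ^_ (2 * c + y))%:R :> R.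
Proof.
rewrite /max_neg_hypergeometric_pmf; case: leqP => // y_big.
by rewrite !(@ffact_small _ (c + y)) ?(mul0r, mulr0, addr0)//; lia.
Qed.

Lemma cvg_max_neg_hypergeometric_pmf (R : realType) (c : nat) (p : R)
    (N m : nat -> nat) (y : nat) :
  (forall k, m k <= N k)%N -> (forall k, 0 < N k)%N ->
  N k @[k --> \oo] --> \oo ->
  (m k)%:R / (N k)%:R @[k --> \oo] --> p ->
  max_neg_hypergeometric_pmf (N k) (m k) c y @[k --> \oo] -->
  max_neg_binomial_pmf c p y.
Proof.
move=> mN N0 Noo mp.
have NN k : (N k)%:R != 0 :> R by rewrite pnatr_eq0 -lt0n.
have qlim : (N k - m k)%:R / (N k)%:R @[k --> \oo] --> 1 - p.
  under eq_cvg do rewrite natrB// mulrBl divff//.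
  by apply: cvgB => //; exact: cvg_cst.
have Nlim : (N k)%:R / (N k)%:R @[k --> \oo] --> (1 : R).
  by under eq_cvg do rewrite divff//; exact: cvg_cst.
have fm i := @cvg_ffact_ratio R N m p i Noo mp.
have fq i := @cvg_ffact_ratio R N (fun k => N k - m k)%N (1 - p) i Noo qlim.
have fN i := @cvg_ffact_ratio R N N 1 i Noo Nlim.
have -> : max_neg_binomial_pmf c p y = 'C(2 * c + y - 1, c - 1)%:R *
    (p ^+ (c + y) * (1 - p) ^+ c + p ^+ c * (1 - p) ^+ (c + y)) /
    1 ^+ (2 * c + y).
  by rewrite /max_neg_binomial_pmf expr1n divr1 exprMn !exprD; ring.
(* Dividing numerator and denominator by N ^ (2c + y) gives one power of N to
     each falling factorial. *)
rewrite (_ : (fun k => _) = fun k => 'C(2 * c + y - 1, c - 1)%:R *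
    ((m k ^_ (c + y))%:R / (N k)%:R ^+ (c + y) *
       (((N k - m k) ^_ c)%:R / (N k)%:R ^+ c) +
     (m k ^_ c)%:R / (N k)%:R ^+ c *
       (((N k - m k) ^_ (c + y))%:R / (N k)%:R ^+ (c + y))) /
    ((N k ^_ (2 * c + y))%:R / (N k)%:R ^+ (2 * c + y))); last first.
  apply/funext => k; rewrite max_neg_hypergeometric_pmfE.
  have -> : (2 * c + y = c + y + c)%N by lia.
  rewrite [_ ^+ (c + y + c)]exprD !invfM !invrK.
  have Nc : (N k)%:R ^+ c != 0 :> R by rewrite expf_neq0.
  have Ncy : (N k)%:R ^+ (c + y) != 0 :> R by rewrite expf_neq0.
  move: ((N k ^_ _)%:R^-1) => D; field.
  by rewrite Nc Ncy.
apply: cvgM; last by apply: cvgV; [rewrite expr1n oner_neq0|exact: fN].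
by apply: cvgMr; apply: cvgD; apply: cvgM.
Qed.

(** Finiteness of the trace of U on the naturals matters: over an infinite set,
    mass could escape to infinity in the limit. *)
Lemma cvg_nat_law (R : realType) (f : nat -> nat -> R) (g : nat -> R)
    (U : set R) :
  (forall k y, 0 <= f k y) -> (forall y, 0 <= g y) ->
  (forall y, f k y @[k --> \oo] --> g y) ->
  finite_set [set y : nat | U y%:R] ->
  nat_law (f k) U @[k --> \oo] --> nat_law g U.
Proof.
move=> f0 g0 fg Ufin.
have lawE (h : nat -> R) : (forall y, 0 <= h y) -> nat_law h U =
    (\sum_(y <- fset_set [set y : nat | U y%:R]) (h y)%:E)%E.
  move=> h0; rewrite /nat_law esum_fset// ?fsbig_finite// => y _.
  by rewrite lee_fin.
rewrite lawE//; under eq_cvg do rewrite lawE//.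
apply: cvg_nnesum => y _; first by apply: nearW => k; rewrite lee_fin.
by apply: cvg_EFin; [exact: nearW|exact: fg].
Qed.

Lemma finite_nat_le (R : realType) (x : R) :
  finite_set [set y : nat | y%:R <= x].
Proof.
apply: (sub_finite_set _ (finite_II (Num.truncn x).+1)) => y /= yx.
by rewrite -(ltr_nat R); apply: le_lt_trans yx _; exact: truncnS_gt.
Qed.

Lemma nat_law_point (R : realType) (f : nat -> R) (y : nat) :
  0 <= f y -> nat_law f [set y%:R] = (f y)%:E.
Proof.
move=> f0; rewrite /nat_law (_ : [set z | _] = [set y]) ?esum_set1 ?lee_fin//.
apply/seteqP; split=> z /= => [/eqP|->//].
by rewrite eqr_nat => /eqP.
Qed.

Theorem lemma1 (R : realType) (c : nat) (p : R) (N m : nat -> nat)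
    (d : nat -> measure_display) (T : forall k, measurableType (d k))
    (P : forall k, probability (T k) R) (Y : forall k, {RV (P k) >-> R}) :
  (1 <= c)%N -> 0 < p < 1 ->
  (forall k, 0 < N k)%N -> (forall k, 0 < m k)%N ->
  N k @[k --> \oo] --> \oo -> m k @[k --> \oo] --> \oo ->
  (forall k, (m k)%:R / (N k)%:R = p) ->
  (forall k, c <= m k)%N -> (forall k, c <= N k - m k)%N ->
  (forall k, has_law (Y k) (max_neg_hypergeometric_prob (N k) (m k) c)) ->
  cvg_in_distribution Y (max_neg_binomial_prob c p) /\
  (forall y : nat, P k (Y k @^-1` [set y%:R]) @[k --> \oo] -->
    ('C(2 * c + y - 1, c - 1)%:R * (p ^+ y + (1 - p) ^+ y)
       * (p * (1 - p)) ^+ c)%:E).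
Proof.
move=> c1 p01 N0 _ Noo _ mNp cm cM lawY.
have mN k : (m k < N k)%N by have := cM k; lia.
have YE k U : measurable U -> distribution (P k) (Y k) U =
    nat_law (max_neg_hypergeometric_pmf (N k) (m k) c) U.
  by move=> mU; rewrite lawY//= /max_neg_hypergeometric_prob c1 cm mN cM.
have pmf_cvg y : max_neg_hypergeometric_pmf (N k) (m k) c y @[k --> \oo] -->
    max_neg_binomial_pmf c p y.
  apply: cvg_max_neg_hypergeometric_pmf => // [k|]; first exact: ltnW.
  by under eq_cvg do rewrite mNp; exact: cvg_cst.
split=> [x _ | y].
  rewrite /= /max_neg_binomial_prob c1 p01 /=.
  rewrite /cdf; under eq_cvg do rewrite YE//.
  apply: cvg_nat_law => // [k y|y|].
  - exact: max_neg_hypergeometric_pmf_ge0.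
  - exact: max_neg_binomial_pmf_ge0.
  - under eq_set do rewrite /= in_itv/=.
    exact: finite_nat_le.
have PE k : P k (Y k @^-1` [set y%:R]) =
    (max_neg_hypergeometric_pmf (N k) (m k) c y)%:E.
  rewrite -[LHS]/(distribution (P k) (Y k) [set y%:R]) YE// nat_law_point//.
  exact: max_neg_hypergeometric_pmf_ge0.
under eq_cvg do rewrite PE.
by apply: cvg_EFin; [exact: nearW|exact: pmf_cvg].
Qed.
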